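(* Let $r\in R$ be a retailer, $b\in\{0,1,2\}$ a level, $l\in T$, $L^b=\{1,\ldots,l\}$ and $S^b\subseteq L^b$. Then the single-level inequality $$\sum_{k\in L^b\setminus S^b}x^{br}_k+\sum_{k\in S^b}d^r_{kl}\,y^{\delta^b_w(r)}_k\ \ge\ d^r_{1l}$$ is valid for $X^{3LF}$, i.e. it is satisfied by every element of $X^{3LF}$.
   Context: Problem data (uncapacitated three-level lot-sizing and replenishment problem with a distribution structure). $T=\{1,\ldots,|T|\}$ is a finite set of consecutive periods. $F=P\cup W\cup R$ is a finite set of facilities (disjoint union), with $P=\{p\}$ (plant, level 0), $W$ the warehouses (level 1), $R$ the retailers (level 2). Each retailer $r\in R$ has a unique warehouse $\delta_w(r)\in W$. Write $\delta^0_w(r)=p$, $\delta^1_w(r)=\delta_w(r)$, $\delta^2_w(r)=r$. Each retailer $r$ has demands $d^r_t\ge 0$, $t\in T$, and $d^r_{kt}=\sum_{l=k}^{t}d^r_l$ for $1\le k\le t\le |T|$. $X^{3LF}$ is the set of all $(x^0,x^1,x^2,s^0,s^1,s^2,y)$, with $x^b=(x^{br}_t)$, $s^b=(s^{br}_t)$ indexed by $r\in R$, $t\in T$ ($b\in\{0,1,2\}$), and $y=(y^i_t)$ indexed by $i\in F$, $t\in T$, with the convention $s^{br}_0=0$, satisfying for all $r\in R$, $t\in T$: - $s^{0r}_{t-1}+x^{0r}_t=x^{1r}_t+s^{0r}_t$; - $s^{1r}_{t-1}+x^{1r}_t=x^{2r}_t+s^{1r}_t$; - $s^{2r}_{t-1}+x^{2r}_t=d^r_t+s^{2r}_t$;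 - $x^{0r}_t\le d^r_{t|T|}y^p_t$, $\ x^{1r}_t\le d^r_{t|T|}y^{\delta_w(r)}_t$, $\ x^{2r}_t\le d^r_{t|T|}y^r_t$; - $x^{0r}_t,x^{1r}_t,x^{2r}_t,s^{0r}_t,s^{1r}_t,s^{2r}_t\ge 0$; and $y^i_t\in\{0,1\}$ for all $i\in F$, $t\in T$. *)

(* Defs.v *)
From HB Require Import structures.
From mathcomp Require Import all_boot all_order all_algebra.

Set Implicit Arguments.
Unset Strict Implicit.
Unset Printing Implicit Defensive.

Import Order.TTheory GRing.Theory Num.Theory.
Local Open Scope ring_scope.

(* The periods 1, ..., |T| are the elements of 'I_n, where
   n = |T|: the ordinal of value i stands for period i + 1. *)

Variant level : Type := Level0 | Level1 | Level2.

(* F = P + W + R (disjoint union) with P = {p}. *)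
Definition facility (W R : finType) : finType := (unit + W + R)%type.

Definition plant (W R : finType) : facility W R := inl (inl tt).
Definition warehouse (W R : finType) (w : W) : facility W R := inl (inr w).
Definition retailer (W R : finType) (r : R) : facility W R := inr r.
Arguments plant {W R}.
Arguments warehouse {W R} w.
Arguments retailer {W R} r.

Definition delta (W R : finType) (dw : R -> W) (b : level) (r : R) :
    facility W R :=
  match b with
  | Level0 => plant
  | Level1 => warehouse (dw r)
  | Level2 => retailer r
  end.

(* The bounds i and j are ordinal values, so that d_{1 l} is cumdemand d r 0 l
   and d_{t |T|} is cumdemand d r t n.-1. *)
Definition cumdemand (K : realFieldType) (n : nat) (R : finType)
    (d : R -> 'I_n -> K) (r : R) (i j : nat) : K :=
  \sum_(u < n | (i <= u <= j)%N) d r u.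

Record point (K : realFieldType) (n : nat) (W R : finType) : Type := Point {
  flow  : level -> R -> 'I_n -> K;
  stock : level -> R -> 'I_n -> K;
  setup : facility W R -> 'I_n -> K
}.

(* s^{br}_{t-1}, with the convention s^{br}_0 = 0.  The cyclic predecessor
   ord_pred has value t.-1 whenever t is not the first period. *)
Definition prev_stock (K : realFieldType) (n : nat) (W R : finType)
    (v : point K n W R) (b : level) (r : R) (t : 'I_n) : K :=
  if (t == 0 :> nat)%N then 0 else stock v b r (ord_pred t).

Record X3LF (K : realFieldType) (n : nat) (W R : finType)
    (dw : R -> W) (d : R -> 'I_n -> K) (v : point K n W R) : Prop := InX3LF {
  balance0 : forall r t,
    prev_stock v Level0 r t + flow v Level0 r t
      = flow v Level1 r t + stock v Level0 r t;
  balance1 : forall r t,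
    prev_stock v Level1 r t + flow v Level1 r t
      = flow v Level2 r t + stock v Level1 r t;
  balance2 : forall r t,
    prev_stock v Level2 r t + flow v Level2 r t
      = d r t + stock v Level2 r t;
  setup_bound0 : forall r t,
    flow v Level0 r t <= cumdemand d r t n.-1 * setup v plant t;
  setup_bound1 : forall r t,
    flow v Level1 r t <= cumdemand d r t n.-1 * setup v (warehouse (dw r)) t;
  setup_bound2 : forall r t,
    flow v Level2 r t <= cumdemand d r t n.-1 * setup v (retailer r) t;
  flow_ge0 : forall b r t, 0 <= flow v b r t;
  stock_ge0 : forall b r t, 0 <= stock v b r t;
  setup_binary : forall i t, setup v i t = 0 \/ setup v i t = 1
}.

Definition first_periods (n : nat) (l : 'I_n) : {set 'I_n} :=
  [set k : 'I_n | (k <= l)%N].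

(* Main.v *)
Require Import Defs.
From mathcomp Require Import all_boot all_order all_algebra.

Set Implicit Arguments.
Unset Strict Implicit.
Unset Printing Implicit Defensive.

Import Order.TTheory GRing.Theory Num.Theory.
Local Open Scope ring_scope.

(** Flow conservation and nonnegative stocks make the cumulative flow of every
    level dominate the cumulative demand. Let m be the first period of S with a
    setup (the period after l if there is none). Before m the flow vanishes on
    S, so the flow terms of the inequality cover the demand of the periods
    before m, while the setup term of m covers the demand of m, ..., l. *)

(** Adding up the balance equations telescopes the stocks: the initial one is zero, so only the last
    one survives. *)
Lemma cumulative_balance (K : zmodType) (n : nat) (f g s : 'I_n -> K) :
    (forall t : 'I_n,
      (if (t == 0 :> nat)%N then 0 else s (ord_pred t)) + f t = g t + s t) ->
  forall t : 'I_n,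
    \sum_(u < n | (u <= t)%N) f u = \sum_(u < n | (u <= t)%N) g u + s t.
Proof.
move=> bal [m]; elim: m => [|m IHm] ltmn.
  have eq0 (u : 'I_n) : (u <= 0)%N = (u == Ordinal ltmn).
    by rewrite leqn0 -val_eqE.
  by rewrite /= !(eq_bigl _ _ eq0) !big_pred1_eq -bal /= add0r.
set t := Ordinal ltmn; have lt'mn := ltnW ltmn.
(* The value of [t] is [m.+1], so the cyclic predecessor does not wrap around. *)
have predt : ord_pred t = Ordinal lt'mn.
  by apply/val_inj; rewrite /= modnDr modn_small.
have splitt (h : 'I_n -> K) :
    \sum_(u < n | (u <= t)%N) h u = h t + \sum_(u < n | (u <= m)%N) h u.
  rewrite (bigD1 t) //=; congr (_ + _); apply: eq_bigl => u.
  by rewrite -val_eqE /= andbC -ltn_neqAle ltnS.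
have {bal} balt : s (Ordinal lt'mn) + f t = g t + s t by rewrite -predt -bal.
by rewrite !splitt (IHm lt'mn) addrCA [f t + _]addrC balt addrCA addrA.
Qed.

(** The surplus is the last stock. The strict bound [u < m] admits the empty prefix, which occurs
    when the first setup is in the first period. *)
Lemma cumulative_flow_ge (K : numDomainType) (n : nat) (f g s : 'I_n -> K) :
    (forall t, 0 <= s t) ->
    (forall t : 'I_n,
      (if (t == 0 :> nat)%N then 0 else s (ord_pred t)) + f t = g t + s t) ->
  forall m : nat, (m <= n)%N ->
    \sum_(u < n | (u < m)%N) g u <= \sum_(u < n | (u < m)%N) f u.
Proof.
move=> s_ge0 bal [|m] lemn; first by rewrite !big_pred0.
by rewrite (cumulative_balance bal (Ordinal lemn)) lerDl.
Qed.

(** Surpluses chain up the levels: demand is dominated by the flow of level 2, that by level 1, and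
    that by level 0. *)
Lemma cumulative_demand_le_flow (K : realFieldType) (n : nat) (W R : finType)
    (dw : R -> W) (d : R -> 'I_n -> K) (v : point K n W R) (b : level) (r : R)
    (m : nat) :
    X3LF dw d v -> (m <= n)%N ->
  \sum_(u < n | (u < m)%N) d r u <= \sum_(u < n | (u < m)%N) flow v b r u.
Proof.
move=> Xv lemn.
have le2 := cumulative_flow_ge (stock_ge0 Xv Level2 r) (balance2 Xv r) lemn.
have le1 := cumulative_flow_ge (stock_ge0 Xv Level1 r) (balance1 Xv r) lemn.
have le0 := cumulative_flow_ge (stock_ge0 Xv Level0 r) (balance0 Xv r) lemn.
case: b => //; last exact: le_trans le1.
exact: le_trans (le_trans le2 le1) le0.
Qed.

Lemma flow_le_setup (K : realFieldType) (n : nat) (W R : finType)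
    (dw : R -> W) (d : R -> 'I_n -> K) (v : point K n W R) (b : level) (r : R)
    (t : 'I_n) :
    X3LF dw d v ->
  flow v b r t <= cumdemand d r t n.-1 * setup v (delta dw b r) t.
Proof.
move=> Xv; case: b => /=.
- exact: (setup_bound0 Xv).
- exact: (setup_bound1 Xv).
- exact: (setup_bound2 Xv).
Qed.

Theorem proposition4 (K : realFieldType) (n : nat) (W R : finType)
    (dw : R -> W) (d : R -> 'I_n -> K) (hd : forall r t, 0 <= d r t)
    (r : R) (b : level) (l : 'I_n) (S : {set 'I_n})
    (hS : S \subset first_periods l) :
  forall v : point K n W R, X3LF dw d v ->
    \sum_(k in first_periods l :\: S) flow v b r k
      + \sum_(k in S) cumdemand d r k l * setup v (delta dw b r) k
    >= cumdemand d r 0 l.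
Proof.
move=> v Xv; pose y := setup v (delta dw b r).
have cum_ge0 i j : 0 <= cumdemand d r i j by apply: sumr_ge0.
have term_ge0 (k : 'I_n) : 0 <= cumdemand d r k l * y k.
  by rewrite mulr_ge0 // /y; case: (setup_binary Xv (delta dw b r) k) => ->.
have [m [lem y0 setup_ge]] : exists m, [/\ (m <= l.+1)%N,
    forall k : 'I_n, k \in S -> (k < m)%N -> y k = 0
    & cumdemand d r m l <= \sum_(k in S) cumdemand d r k l * y k].
  pose P k := (k \in S) && (y k == 1).
  case: (pickP P) => [k0 Pk0|noSetup].
    case: (@arg_minnP _ k0 P val Pk0) => k /andP[kS /eqP yk] kmin.
    exists k; split.
    - by have := subsetP hS k kS; rewrite inE => /leqW.
    - move=> i iS ltik; case: (setup_binary Xv (delta dw b r) i) => // yi.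
      by have := kmin i; rewrite /P iS /y yi eqxx leqNgt ltik => /(_ isT).
    (* As [y k = 1], the term of [k] alone equals the left-hand side. *)
    - by rewrite (bigD1 k) //= yk mulr1 lerDl sumr_ge0.
  exists l.+1; split=> // [k kS _|].
    case: (setup_binary Xv (delta dw b r) k) => // yk.
    by have := noSetup k; rewrite /P kS /y yk eqxx.
  (* For [m = l.+1] the remaining demand is an empty sum. *)
  rewrite [leLHS]big_pred0 ?sumr_ge0 // => u.
  by case: (ltnP l u).
have -> : cumdemand d r 0 l
    = \sum_(u < n | (u < m)%N) d r u + cumdemand d r m l.
  (* The periods before [m] all lie in the range up to [l] because [m <= l.+1]. *)
  rewrite /cumdemand (bigID (fun u : 'I_n => (u < m)%N)) /=.
  congr (_ + _); apply: eq_bigl => u; last by rewrite -leqNgt andbC.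
  by case: ltnP => [ltum|_]; rewrite ?andbF // -ltnS (leq_trans ltum).
apply: lerD setup_ge.
have lemn : (m <= n)%N by apply: leq_trans lem (ltn_ord l).
apply: le_trans (cumulative_demand_le_flow b r Xv lemn) _.
(* With both sums extended by zero to all periods, the comparison is termwise. The only delicate
   case is [u < m] with [u] in [S]: the right term is missing, but the setup bound with [y u = 0]
   forces the flow to be at most 0. *)
rewrite big_mkcond [leRHS]big_mkcond; apply: ler_sum => u _.
have [ltum|_] := ifPn; last by case: ifP => // _; exact: (flow_ge0 Xv).
rewrite !inE -ltnS (leq_trans ltum lem) andbT.
have [uS|//] := boolP (u \in S).
by have := flow_le_setup b r u Xv; rewrite -/y y0 // mulr0.
Qed.
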